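(* Let $\lambda\in[-1,1]$. Let $q=(q_n)_{n\ge 0}$ be a sequence of non-negative real numbers with $q_0>0$ and $Q_n=\sum_{k=0}^n q_k\to\infty$ as $n\to\infty$, and let $A=(a_{nk})$ be a weighted non-negative regular summability matrix (with respect to $q$). Then for every $f\in C[0,1]$, $$S_A^{\widetilde N}\text{-}\lim_{n\to\infty}\ \|B_{n,\lambda}(f;\cdot)-f\|_{C[0,1]}=0,$$ i.e. the sequence of real numbers $\|B_{n,\lambda}(f;\cdot)-f\|_{C[0,1]}$, $n\ge 2$, is weighted $A$-statistically convergent to $0$.
   Context: $C[0,1]$ is the space of real continuous functions on $[0,1]$ with the sup norm $\|\cdot\|_{C[0,1]}$. $\lambda$-Bernstein operators: for $n\ge 2$, $0\le i\le n$, $x\in[0,1]$ let $b_{n,i}(x)=\binom{n}{i}x^i(1-x)^{n-i}$. For $\lambda\in[-1,1]$ define $\tilde b_{n,0}(\lambda;x)=b_{n,0}(x)-\frac{\lambda}{n+1}b_{n+1,1}(x)$, $\tilde b_{n,i}(\lambda;x)=b_{n,i}(x)+\lambda\left(\frac{n-2i+1}{n^2-1}b_{n+1,i}(x)-\frac{n-2i-1}{n^2-1}b_{n+1,i+1}(x)\right)$ for $1\le i\le n-1$, $\tilde b_{n,n}(\lambda;x)=b_{n,n}(x)-\frac{\lambda}{n+1}b_{n+1,n}(x)$, and $B_{n,\lambda}(f;x)=\sum_{i=0}^n f(i/n)\,\tilde b_{n,i}(\lambda;x)$. Weighted $A$-statistical convergence: $A=(a_{nk})$ ($n\ge 0$,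 $k\ge 1$) is an infinite matrix with non-negative entries. It is weighted regular (with respect to $q$) if for every convergent real sequence $(x_k)_{k\ge1}$ with limit $L$ the quantities $\frac{1}{Q_n}\sum_{m=0}^n\sum_{k=1}^\infty q_m a_{mk}x_k$ are well defined and converge to $L$ as $n\to\infty$. For $K\subseteq\mathbb N$ the weighted $A$-density of $K$ is $\delta_A^{\widetilde N}(K)=\lim_{n\to\infty}\frac{1}{Q_n}\sum_{m=0}^n\sum_{k\in K}q_m a_{mk}$ when the limit exists. A real sequence $(x_k)$ (defined for all but finitely many $k\in\mathbb N$) is weighted $A$-statistically convergent to $L$, written $S_A^{\widetilde N}\text{-}\lim x_k=L$, if for every $\varepsilon>0$ the set $\{k:|x_k-L|\ge\varepsilon\}$ has weighted $A$-density $0$. *)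

(* Defs.v *)
From mathcomp Require Import all_boot all_order all_algebra.
From mathcomp Require Import all_classical all_reals all_analysis.
Set Implicit Arguments.
Unset Strict Implicit.
Unset Printing Implicit Defensive.
Import Order.TTheory GRing.Theory Num.Theory.
Import numFieldNormedType.Exports.
Local Open Scope classical_set_scope.
Local Open Scope ring_scope.

(* The functions in C[0,1] are represented by total functions R -> R of which
   only the restriction to [0,1] matters. *)
Definition sup_norm01 (R : realType) (g : R -> R) : R :=
  sup [set `|g x| | x in `[0, 1]].

Definition bernstein_basis (R : realType) (n i : nat) (x : R) : R :=
  'C(n, i)%:R * x ^+ i * (1 - x) ^+ (n - i).

(* All differences such as n - 2i - 1 are taken in R, not in nat.  Only meant
   for n >= 2 and i <= n. *)
Definition lambda_bernstein_basis (R : realType) (n i : nat) (lambda x : R)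
    : R :=
  if i == 0%N then
    bernstein_basis n 0 x - lambda / (n%:R + 1) * bernstein_basis n.+1 1 x
  else if i == n then
    bernstein_basis n n x - lambda / (n%:R + 1) * bernstein_basis n.+1 n x
  else
    bernstein_basis n i x + lambda *
      ((n%:R - 2 * i%:R + 1) / (n%:R ^+ 2 - 1) * bernstein_basis n.+1 i x
       - (n%:R - 2 * i%:R - 1) / (n%:R ^+ 2 - 1) * bernstein_basis n.+1 i.+1 x).

Definition lambda_bernstein (R : realType) (n : nat) (lambda : R) (f : R -> R)
    (x : R) : R :=
  \sum_(0 <= i < n.+1) f (i%:R / n%:R) * lambda_bernstein_basis n i lambda x.

Definition partial_weight (R : realType) (q : nat -> R) (n : nat) : R :=
  \sum_(0 <= k < n.+1) q k.

(* Matrices are indexed by n >= 0 and k >= 1: the column k = 0 of [a] and the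
   term of index 0 of a sequence (x_k) are never used. *)
Definition nonneg_matrix (R : realType) (a : nat -> nat -> R) : Prop :=
  forall n k, (1 <= k)%N -> 0 <= a n k.

(* Being well defined means that the inner series converge; it has to be
   required, since limits (hence infinite sums) are total in the library. *)
Definition weighted_regular (R : realType) (q : nat -> R)
    (a : nat -> nat -> R) : Prop :=
  forall (x : nat -> R) (L : R), x @ \oo --> L ->
    (forall m, cvgn (fun N => \sum_(1 <= k < N) q m * a m k * x k)) /\
    (partial_weight q n)^-1 *
      (\sum_(0 <= m < n.+1)
         limn (fun N => \sum_(1 <= k < N) q m * a m k * x k))
      @[n --> \oo] --> L.

(* "The weighted A-density of K exists and equals d." *)
Definition has_weighted_density (R : realType) (q : nat -> R)
    (a : nat -> nat -> R) (K : set nat) (d : R) : Prop :=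
  (forall m, cvgn (fun N => \sum_(1 <= k < N | k \in K) q m * a m k)) /\
  (partial_weight q n)^-1 *
    (\sum_(0 <= m < n.+1)
       limn (fun N => \sum_(1 <= k < N | k \in K) q m * a m k))
    @[n --> \oo] --> d.

(* Weighted A-statistical convergence to L of the sequence (x_k), k >= k0; the
   values of [x] below k0 are irrelevant. *)
Definition weighted_stat_cvg (R : realType) (q : nat -> R)
    (a : nat -> nat -> R) (k0 : nat) (x : nat -> R) (L : R) : Prop :=
  forall eps : R, 0 < eps ->
    has_weighted_density q a [set k | (k0 <= k)%N /\ eps <= `|x k - L|] 0.

(* Main.v *)
(** The norms converge to 0 in the ordinary sense; hence each exceptional set of
    indices is eventually empty, its indicator is a null sequence, and applying
    regularity to that indicator gives density 0.

    For the ordinary convergence, [lambda_bernstein] is compared with the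
    classical Bernstein operator: each basis function changes by at most
    [(b_(n+1,i) + b_(n+1,i+1)) / (n - 1)], which sums to at most [2 / (n - 1)].
    The classical operator is handled by Bernstein's argument: the bound
    [|f x - f y| <= e + c (x - y)^2] is integrated against the binomial weights,
    whose variance is [x (1 - x) / n]. *)
Require Import Defs.
From mathcomp Require Import all_boot all_order all_algebra ring lra.
From mathcomp Require Import all_classical all_reals all_analysis.
Import Order.TTheory GRing.Theory Num.Theory.
Import numFieldNormedType.Exports.
Local Open Scope classical_set_scope.
Local Open Scope ring_scope.

(** * Continuous functions on a segment *)

(** Compactness in near-covering form: a property of [d] and [x] that holds for small [d > 0]
    locally around each point holds for a common [d] on the whole segment. *)
Lemma uniform_continuous_on_segment (R : realType) (f : R -> R) (a b : R) :
  {within `[a, b], continuous f} -> forall e : R, 0 < e ->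
  exists2 d : R, 0 < d & forall x y, x \in `[a, b] -> y \in `[a, b] ->
    `|x - y| < d -> `|f x - f y| <= e.
Proof.
move=> /subspace_continuousP cf e e0.
have /compact_near_coveringP/near_covering_withinP/(_ R 0^'+ (fun d x =>
  forall y, y \in `[a, b] -> `|x - y| < d -> `|f x - f y| <= e)) :=
  @segment_compact R a b.
move=> /(_ _)[].
  move=> x xab.
  have /cvgrPdist_lt/(_ (e / 2)) := cf x xab.
  rewrite divr_gt0// => /(_ isT) [r /= r0 fr].
  have near_x z : z \in `[a, b] -> `|x - z| < r -> `|f x - f z| < e / 2.
    by move=> zab xz; apply: fr.
  have r20 : 0 < r / 2 by rewrite divr_gt0.
  (* With [x'] within [r / 2] of [x] and [y] within [r / 2] of [x'], both stay within [r] of [x]. *)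
  exists (ball x (r / 2), [set d | d < r / 2]).
    by split; [exact: nbhsx_ballx|exact: nbhs_right_lt].
  move=> [x' d] /= [xx' dr] x'ab y yab x'y.
  have fx' : `|f x - f x'| < e / 2.
    by apply: near_x => //; apply: lt_trans xx' _; lra.
  have fy : `|f x - f y| < e / 2.
    apply: near_x => //; rewrite (_ : x - y = (x - x') + (x' - y)); last by ring.
    apply: le_lt_trans (ler_normD _ _) _; move: xx'; rewrite /ball /=.
    by lra.
  rewrite (_ : f x' - f y = (f x - f y) - (f x - f x')); last by ring.
  by apply: le_trans (ler_normB _ _) _; lra.
move=> r /= r0 fr; exists (r / 2); first by rewrite divr_gt0.
move=> x y xab; apply: (fr (r / 2)) => //=; last by rewrite divr_gt0.
by rewrite sub0r normrN gtr0_norm ?divr_gt0//; lra.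
Qed.

Lemma bounded_on_segment (R : realType) (f : R -> R) (a b : R) :
  {within `[a, b], continuous f} ->
  exists2 M : R, 0 < M & forall x, x \in `[a, b] -> `|f x| <= M.
Proof.
move=> cf; have /compact_bounded[M [_ fM]] :=
  continuous_compact cf (@segment_compact R a b).
(* Boundedness only provides the bounds strictly above [M]; this one is also positive. *)
exists (`|M| + 1); first by rewrite ltr_wpDl.
move=> x xab; apply: (fM (`|M| + 1)); last by exists x.
by rewrite (le_lt_trans (ler_norm M))// ltrDl.
Qed.

(** Uniform continuity gives [e] when [x] and [y] are closer than [d]; otherwise [2 * M] is a bound,
    and [(x - y) ^+ 2 / d ^+ 2] is at least 1. *)
Lemma quadratic_modulus (R : realType) (f : R -> R) (a b : R) :
  {within `[a, b], continuous f} -> forall e : R, 0 < e ->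
  exists2 c : R, 0 <= c & forall x y, x \in `[a, b] -> y \in `[a, b] ->
    `|f x - f y| <= e + c * (x - y) ^+ 2.
Proof.
move=> cf e e0; have [M M0 fM] := bounded_on_segment _ _ _ _ cf.
have [d d0 fd] := uniform_continuous_on_segment _ _ _ _ cf _ e0.
have c0 : 0 <= 2 * M / d ^+ 2 by rewrite divr_ge0 ?exprn_ge0 ?mulr_ge0// ltW.
exists (2 * M / d ^+ 2) => // x y xab yab.
have [xyd|dxy] := ltP `|x - y| d.
  by rewrite (le_trans (fd _ _ xab yab xyd))// lerDl mulr_ge0// sqr_ge0.
apply: le_trans (_ : 2 * M <= _).
  have := fM _ xab; have := fM _ yab; have := ler_normB (f x) (f y); lra.
have : d ^+ 2 <= (x - y) ^+ 2.
  by rewrite -[leRHS]real_normK ?num_real// lerXn2r ?nnegrE// ltW.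
move=> dxy2; apply: le_trans (_ : 2 * M / d ^+ 2 * d ^+ 2 <= _).
  by rewrite divfK// expf_neq0// gt_eqF.
by rewrite ler_wpDl ?(ltW e0)// ler_wpM2l.
Qed.

(** * The Bernstein basis and its moments *)

Lemma bernstein_basis_ge0 (R : realType) n i (x : R) :
  0 <= x <= 1 -> 0 <= bernstein_basis n i x.
Proof.
by move=> /andP[x0 x1]; rewrite !mulr_ge0 ?exprn_ge0 ?subr_ge0.
Qed.

Lemma bernstein_basis_small (R : realType) n i (x : R) :
  (n < i)%N -> bernstein_basis n i x = 0.
Proof. by move=> ni; rewrite /bernstein_basis bin_small// !mul0r. Qed.

Lemma bernstein_basis0S (R : realType) n (x : R) :
  bernstein_basis n.+1 0 x = (1 - x) * bernstein_basis n 0 x.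
Proof. by rewrite /bernstein_basis !bin0 !subn0 exprS; ring. Qed.

Lemma bernstein_basisSS (R : realType) n i (x : R) :
  bernstein_basis n.+1 i.+1 x =
  (1 - x) * bernstein_basis n i.+1 x + x * bernstein_basis n i x.
Proof.
rewrite /bernstein_basis subSS binS natrD exprS.
(* For [n <= i] the truncated exponents [n - i] and [n - i.+1] coincide, but the binomial
   coefficient ['C(n, i.+1)] vanishes. *)
have [ni|ni] := leqP n i; first by rewrite (bin_small (_ : n < i.+1)%N)//; ring.
by rewrite -[(n - i)%N]prednK ?subn_gt0// -subnS exprS; ring.
Qed.

(** Pascal's rule in summed form, with an arbitrary weight [g]: it drives the inductions on [n] for
    the moments. *)
Lemma sum_bernstein_basisS (R : realType) (g : nat -> R) n (x : R) :
  \sum_(0 <= i < n.+2) g i * bernstein_basis n.+1 i x =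
  (1 - x) * \sum_(0 <= i < n.+1) g i * bernstein_basis n i x +
  x * \sum_(0 <= i < n.+1) g i.+1 * bernstein_basis n i x.
Proof.
have -> : \sum_(0 <= i < n.+1) g i * bernstein_basis n i x =
          \sum_(0 <= i < n.+2) g i * bernstein_basis n i x.
  by rewrite [RHS]big_nat_recr//= bernstein_basis_small// mulr0 addr0.
rewrite !(@big_nat_recl _ _ _ n.+1)//= bernstein_basis0S mulrDr -addrA.
congr (_ + _); first by ring.
rewrite !mulr_sumr -big_split/=; apply: eq_bigr => i _.
by rewrite bernstein_basisSS; ring.
Qed.

Lemma sum_bernstein_basis (R : realType) n (x : R) :
  \sum_(0 <= i < n.+1) bernstein_basis n i x = 1.
Proof.
elim: n => [|n IH]; first by rewrite big_nat1 /bernstein_basis bin0 !mulr1.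
have := sum_bernstein_basisS _ (fun=> 1) n x.
under eq_bigr do rewrite mul1r; under [X in _ * X + _]eq_bigr do rewrite mul1r.
under [X in _ + _ * X]eq_bigr do rewrite mul1r.
by rewrite IH => ->; ring.
Qed.

Lemma bernstein_basis_second_moment (R : realType) n (x c : R) :
  \sum_(0 <= i < n.+1) (i%:R - c) ^+ 2 * bernstein_basis n i x =
  n%:R * x * (1 - x) + (n%:R * x - c) ^+ 2.
Proof.
(* The centre [c] is kept arbitrary because Pascal's rule shifts it to [c - 1]. *)
elim: n c => [|n IH] c.
  by rewrite big_nat1 /bernstein_basis bin0 !expr0; ring.
rewrite (sum_bernstein_basisS _ (fun i => (i%:R - c) ^+ 2)) IH.
under [X in _ + x * X]eq_bigr => i _.
  rewrite (_ : i.+1%:R - c = i%:R - (c - 1)); last by rewrite -natr1; ring.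
  over.
by rewrite IH -natr1; ring.
Qed.

(** * Uniform convergence of the operators *)

(** Since [n ^ 2 - 1 = (n + 1) (n - 1)] and the numerators are at most [n + 1] in absolute value,
    every coefficient is at most [1 / (n - 1)]. *)
Lemma lambda_bernstein_basis_dist (R : realType) n i (lambda x : R) :
  -1 <= lambda <= 1 -> (2 <= n)%N -> (i <= n)%N -> 0 <= x <= 1 ->
  `|lambda_bernstein_basis n i lambda x - bernstein_basis n i x| <=
  (bernstein_basis n.+1 i x + bernstein_basis n.+1 i.+1 x) / (n%:R - 1).
Proof.
move=> lambda1 n2 i_le_n x01.
have b0 k := bernstein_basis_ge0 _ n.+1 k _ x01.
have lambda_le1 : `|lambda| <= 1 by rewrite ler_norml.
have n2R : 2 <= n%:R :> R by rewrite ler_nat.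
have nB1 : 0 < n%:R - 1 :> R by lra.
have nD1 : 0 < n%:R + 1 :> R by lra.
have endpoint b : 0 <= b -> `|lambda / (n%:R + 1) * b| <= b / (n%:R - 1).
  move=> b_ge0; rewrite !normrM normfV (gtr0_norm nD1) (ger0_norm b_ge0) mulrC.
  rewrite ler_wpM2l// (le_trans (ler_wpM2r _ lambda_le1)) ?invr_ge0 ?(ltW nD1)//.
  by rewrite mul1r lef_pV2 ?posrE//; lra.
have inner (t b : R) : 0 <= b -> `|t| <= n%:R + 1 ->
    `|t / (n%:R ^+ 2 - 1) * b| <= b / (n%:R - 1).
  move=> b_ge0 tn; have -> : n%:R ^+ 2 - 1 = (n%:R + 1) * (n%:R - 1) :> R by ring.
  rewrite !normrM normfV normrM (gtr0_norm nD1) (gtr0_norm nB1) (ger0_norm b_ge0).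
  rewrite mulrC ler_wpM2l// invfM mulrA ler_piMl ?invr_ge0 ?(ltW nB1)//.
  by rewrite ler_pdivrMr// mul1r.
(* At the ends one term of the bound suffices: the second for [i = 0], the first for [i = n]. *)
rewrite mulrDl /lambda_bernstein_basis; case: eqP => [->|i0].
  rewrite addrAC subrr add0r normrN ler_wpDl ?endpoint//.
  by rewrite divr_ge0 ?(ltW nB1).
case: eqP => [->|i_ne_n].
  rewrite addrAC subrr add0r normrN ler_wpDr ?endpoint//.
  by rewrite divr_ge0 ?(ltW nB1).
have i_leR : i%:R <= n%:R :> R by rewrite ler_nat.
have i_ge0 : 0 <= i%:R :> R by [].
have i_ltn : i%:R + 1 <= n%:R :> R.
  by rewrite natr1 ler_nat ltn_neqAle i_le_n andbT; apply/eqP.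
rewrite addrAC subrr add0r normrM.
apply: (le_trans (ler_wpM2r (normr_ge0 _) lambda_le1)); rewrite mul1r.
apply: (le_trans (ler_normB _ _)); apply: lerD.
  by apply: inner => //; rewrite ler_norml; apply/andP; split; lra.
by apply: inner => //; rewrite ler_norml; apply/andP; split; lra.
Qed.

Lemma natr_ratio01 (R : realType) i n : (0 < n)%N -> (i <= n)%N ->
  (i%:R / n%:R : R) \in `[0, 1].
Proof.
move=> n0 i_le_n; rewrite in_itv/= divr_ge0//= ler_pdivrMr ?ltr0n//.
by rewrite mul1r ler_nat.
Qed.

Lemma bernstein_second_moment_ratio (R : realType) n (x : R) : (0 < n)%N ->
  \sum_(0 <= i < n.+1) (i%:R / n%:R - x) ^+ 2 * bernstein_basis n i x =
  x * (1 - x) / n%:R.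
Proof.
move=> n0; have n0R : n%:R != 0 :> R by rewrite pnatr_eq0 -lt0n.
under eq_bigr => i _.
  rewrite (_ : _ * _ = (i%:R - n%:R * x) ^+ 2 * bernstein_basis n i x / n%:R ^+ 2);
    last by field.
  over.
by rewrite -mulr_suml bernstein_basis_second_moment; field.
Qed.

Lemma lambda_bernstein_dist (R : realType) (lambda e c M : R) (f : R -> R) n x :
  -1 <= lambda <= 1 -> (2 <= n)%N -> x \in `[0, 1] -> 0 <= c ->
  (forall y, y \in `[0, 1] -> `|f y| <= M) ->
  (forall y, y \in `[0, 1] -> `|f y - f x| <= e + c * (y - x) ^+ 2) ->
  `|lambda_bernstein n lambda f x - f x| <= e + (c + 2 * M) / (n%:R - 1).
Proof.
move=> lambda1 n2 xI c0 fM fc.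
have x01 : 0 <= x <= 1 by move: xI; rewrite in_itv.
have n0 : (0 < n)%N by apply: leq_trans n2.
have n2R : 2 <= n%:R :> R by rewrite ler_nat.
have nB1 : 0 < n%:R - 1 :> R by lra.
have b0 m i := bernstein_basis_ge0 _ m i _ x01.
have M0 : 0 <= M := le_trans (normr_ge0 _) (fM _ xI).
(* [S1] is the error of the classical operator, because the basis sums to 1; [S2] is the
   perturbation due to [lambda]. *)
pose S1 := \sum_(0 <= i < n.+1) (f (i%:R / n%:R) - f x) * bernstein_basis n i x.
pose S2 := \sum_(0 <= i < n.+1) f (i%:R / n%:R) *
  (lambda_bernstein_basis n i lambda x - bernstein_basis n i x).
have -> : lambda_bernstein n lambda f x - f x = S1 + S2.
  rewrite -[X in _ - X]mulr1 -(sum_bernstein_basis _ n x) mulr_sumr.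
  rewrite /lambda_bernstein /S1 /S2 -sumrB -big_split/=.
  by apply: eq_bigr => i _; ring.
have S1_le : `|S1| <= e + c / (n%:R - 1).
  apply: (le_trans (ler_norm_sum _ _ _)).
  apply: (@le_trans _ _ (\sum_(0 <= i < n.+1) (e * bernstein_basis n i x +
      c * ((i%:R / n%:R - x) ^+ 2 * bernstein_basis n i x)))).
    apply: ler_sum_nat => i /andP[_ i_le_n].
    rewrite normrM (ger0_norm (b0 _ _)) (mulrA c) -mulrDl ler_wpM2r//.
    exact/fc/natr_ratio01.
  rewrite big_split/= -!mulr_sumr sum_bernstein_basis mulr1.
  rewrite bernstein_second_moment_ratio// lerD2l ler_wpM2l//.
  (* The variance is bounded crudely, to share the denominator [n - 1] with [S2]. *)
  apply: (@le_trans _ _ (1 / n%:R)).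
    by rewrite ler_wpM2r ?invr_ge0//; nra.
  by rewrite mul1r lef_pV2 ?posrE ?ltr0n//; lra.
have S2_le : `|S2| <= 2 * M / (n%:R - 1).
  apply: (le_trans (ler_norm_sum _ _ _)).
  apply: (@le_trans _ _ (\sum_(0 <= i < n.+1) M * ((bernstein_basis n.+1 i x +
      bernstein_basis n.+1 i.+1 x) / (n%:R - 1)))).
    apply: ler_sum_nat => i /andP[_ i_le_n].
    rewrite normrM ler_pM//; first exact/fM/natr_ratio01.
    exact: lambda_bernstein_basis_dist.
  rewrite -mulr_sumr -mulr_suml big_split/= mulrA ler_wpM2r ?invr_ge0 ?(ltW nB1)//.
  rewrite mulrC ler_wpM2r//.
  (* Each of the two sums misses one end term of the full basis of degree [n.+1], so it is at most
     1. *)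
  have sum1 := sum_bernstein_basis _ n.+1 x.
  have : \sum_(0 <= i < n.+1) bernstein_basis n.+1 i x <= 1.
    by rewrite -sum1 [leRHS]big_nat_recr//= lerDl.
  have : \sum_(0 <= i < n.+1) bernstein_basis n.+1 i.+1 x <= 1.
    by rewrite -sum1 [leRHS]big_nat_recl//= lerDr.
  by lra.
by apply: (le_trans (ler_normD _ _)); rewrite mulrDl; lra.
Qed.

Lemma lambda_bernstein_cvg (R : realType) (lambda : R) (f : R -> R) :
  -1 <= lambda <= 1 -> {within `[0, 1], continuous f} ->
  sup_norm01 (fun x => lambda_bernstein n lambda f x - f x) @[n --> \oo] --> 0.
Proof.
move=> lambda1 cf; apply/cvgrPdist_le => e e0.
have [M M0 fM] := bounded_on_segment _ _ _ _ cf.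
have e20 : 0 < e / 2 by rewrite divr_gt0.
have [c c0 fc] := quadratic_modulus _ _ _ _ cf _ e20.
near=> n.
have n2 : (2 <= n)%N by near: n; exact: nbhs_infty_ge.
have nB1 : 0 < n%:R - 1 :> R by rewrite subr_gt0 ltr1n.
have bound x : x \in `[0, 1] ->
    `|lambda_bernstein n lambda f x - f x| <= e.
  move=> xI; apply: (@le_trans _ _ (e / 2 + (c + 2 * M) / (n%:R - 1))).
    by apply: lambda_bernstein_dist => // y yI; exact: fc.
  (* This holds once [n >= (c + 2 * M) / (e / 2) + 1], a threshold independent of [x]. *)
  have : (c + 2 * M) / (n%:R - 1) <= e / 2.
    rewrite ler_pdivrMr// [e / 2 * _]mulrC -ler_pdivrMr// lerBrDr.
    by near: n; exact: nbhs_infty_ger.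
  by lra.
(* The point 0 shows that the set is nonempty, as the upper bound on [sup] requires, and that its
   supremum is nonnegative. *)
have zero_mem : [set `|lambda_bernstein n lambda f x - f x| | x in `[0, 1]]
    `|lambda_bernstein n lambda f 0 - f 0|.
  by exists 0 => //=; rewrite in_itv/= lexx ler01.
rewrite sub0r normrN ger0_norm.
  by apply: ge_sup; [eexists; exact: zero_mem|move=> _ [x xI <-]; exact: bound].
apply: le_trans (normr_ge0 (lambda_bernstein n lambda f 0 - f 0)) _.
by apply: ub_le_sup zero_mem; exists e => _ [x xI <-]; exact: bound.
Unshelve. all: by end_near. Qed.

(** * Weighted density and statistical convergence *)

Lemma weighted_regular_density0 (R : realType) (q : nat -> R)
    (a : nat -> nat -> R) (K : set nat) :
  weighted_regular q a -> (\forall k \near \oo, ~ K k) ->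
  has_weighted_density q a K 0.
Proof.
move=> reg K_fin.
have indicK : (\1_K k : R) @[k --> \oo] --> (0 : R).
  apply: cvg_near_cst; apply: filterS K_fin => k nKk.
  by rewrite indicE memNset.
have [wd lim0] := reg _ _ indicK.
(* Weighting by the indicator and restricting the indices to [K] give the same partial sums, so
   well-definedness and the limit both transfer. *)
have sumK m N : \sum_(1 <= k < N) q m * a m k * \1_K k =
    \sum_(1 <= k < N | k \in K) q m * a m k.
  rewrite [RHS]big_mkcond/=; apply: eq_bigr => k _.
  by rewrite indicE; case: ifP => _; rewrite ?mulr1 ?mulr0.
have sumKE m : (fun N => \sum_(1 <= k < N) q m * a m k * \1_K k) =
    (fun N => \sum_(1 <= k < N | k \in K) q m * a m k).
  exact/funext/sumK.
split=> [m|]; first by rewrite -sumKE.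
by under eq_fun do under eq_bigr do rewrite -sumKE.
Qed.

Theorem theorem3p1 (R : realType) (lambda : R) (q : nat -> R)
    (a : nat -> nat -> R)
    (hlambda : -1 <= lambda <= 1)
    (hq : forall n, 0 <= q n) (hq0 : 0 < q 0%N)
    (hQ : partial_weight q n @[n --> \oo] --> +oo)
    (ha : nonneg_matrix a) (hreg : weighted_regular q a)
    (f : R -> R) (hf : {within `[0, 1], continuous f}) :
  weighted_stat_cvg q a 2
    (fun n => sup_norm01 (fun x => lambda_bernstein n lambda f x - f x)) 0.
Proof.
move=> eps eps0; apply: weighted_regular_density0 => //.
have /cvgrPdist_lt/(_ _ eps0) := lambda_bernstein_cvg _ _ _ hlambda hf.
apply: filterS => k; rewrite distrC => small [_].
by rewrite leNgt small.
Qed.
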